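(* Let $n\ge1$ and let $(P_n,\sigma)$ be any signed graph whose underlying graph is the path $P_n$ on $n$ vertices. Then $$\psi(P_n,\sigma)=\max\Big(\{2x : x\in\mathbb{Z}_{\ge0},\ x^2\le n-1\}\cup\{2x+1 : x\in\mathbb{Z}_{\ge0},\ (x+1)^2-1\le n-1\}\Big).$$
   Context: A signed graph $(G,\sigma)$ is a finite simple graph $G$ with a signature $\sigma:E(G)\to\{-,+\}$. Switching a set $S\subseteq V(G)$ changes the sign of every edge with exactly one end in $S$; two signed graphs on the same underlying graph are equivalent if one is obtained from the other by switching some set of vertices. For $k\ge1$ let $M_k=\{-n,\dots,-1,+1,\dots,+n\}$ if $k=2n$, and $M_k=\{-n,\dots,-1,\pm0,+1,\dots,+n\}$ if $k=2n+1$, where $\pm0$ is a single colour with $-(\pm0)=\pm0$. A $k$-colouring of $(G,\sigma)$ is a map $\phi:V(G)\to M_k$. Let $K_k^*$ be the signed multigraph with vertex set $\{i\ge 0: +i\in M_k\}$ (vertex $0$ standing for colour $\pm0$ when $k$ is odd), in which every two distinct vertices are joined by exactly one positive and one negative edge, and every vertex $i\neq0$ carries exactly one negative loop. Given a $k$-colouring $\phi$, the reduced signed graph $R(G,\sigma,\phi)$ is obtained by (1) switching every vertex with a negative colour $-i$ and recolouring it $+i$; (2) identifying, for each $i$, all vertices of colour $+i$ (resp. $\pm0$) into a single vertex $i$ (resp. $0$), edges inside a class becoming loops; (3) keeping at most one positive and at most one negative edge (or loop) between any two vertices (or at any vertex). The colouring $\phi$ is complete if $R(G,\sigma,\phi)$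 is exactly $K_k^*$. The achromatic number $\psi(G,\sigma)$ is the largest $k\ge1$ such that some signed graph equivalent to $(G,\sigma)$ admits a complete $k$-colouring. *)

(* Defs.v *)
From mathcomp Require Import all_boot all_order all_algebra.

Set Implicit Arguments.
Unset Strict Implicit.
Unset Printing Implicit Defensive.

Import Order.TTheory GRing.Theory Num.Theory.

Record sgraph (T : finType) := SGraph {
  edges : {set {set T}};
  edges_card2 : forall e, e \in edges -> #|e| = 2
}.

(* Signs are booleans: [true] is the negative sign, [false] the positive one.
   A signature is read only on the edges of the graph at hand; its values on
   other sets of vertices are irrelevant. *)
Definition signature (T : finType) := {set T} -> bool.

Section SignedGraphs.
Variable T : finType.
Implicit Types (G : sgraph T) (sigma tau : signature T) (S : {set T}).

Definition switch sigma S : signature T :=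
  fun e => sigma e (+) (#|e :&: S| == 1).

Definition equivalent G sigma tau : Prop :=
  exists S, forall e, e \in edges G -> tau e = switch sigma S e.

End SignedGraphs.

(* The colour set M_k; the self-opposite colour +-0 is the integer 0. *)
Definition colours (k : nat) : pred int :=
  fun z => (`|z|%N <= k./2) && (odd k || (z != 0%R)).

Definition colouring (T : finType) (k : nat) (phi : T -> int) : Prop :=
  forall v, colours k (phi v).

(* Signed multigraphs, loops allowed, with vertices among the natural numbers:
   [mult M s i j] is the number of edges of sign [s] joining [i] and [j], and
   [mult M s i i] the number of loops of sign [s] at [i]. *)
Record smultigraph := SMultigraph {
  vertex : pred nat;
  mult : bool -> nat -> nat -> nat
}.

Definition same_smultigraph (M N : smultigraph) : Prop :=
  vertex M =1 vertex N /\ forall s i j, mult M s i j = mult N s i j.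

Definition Kstar (k : nat) : smultigraph :=
  let V := fun i : nat => colours k (Posz i) in
  SMultigraph V (fun s i j =>
    if V i && V j then
      if i == j then nat_of_bool (s && (i != 0)) else 1
    else 0).

Definition identify (T : finType) (G : sgraph T) (sigma : signature T)
    (c : T -> nat) : smultigraph :=
  SMultigraph
    (fun i => [exists v, c v == i])
    (fun s i j =>
      #|[set e in edges G | (sigma e == s) &&
          [exists u, exists v, [&& e == [set u; v], c u == i & c v == j]]]|).

Definition simplify (M : smultigraph) : smultigraph :=
  SMultigraph (vertex M) (fun s i j => minn 1 (mult M s i j)).

Definition reduced (T : finType) (G : sgraph T) (sigma : signature T)
    (phi : T -> int) : smultigraph :=
  simplify (identify G (switch sigma [set v | (phi v < 0)%R])
                     (fun v => `|phi v|%N)).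

Definition complete_colouring (T : finType) (G : sgraph T)
    (sigma : signature T) (k : nat) (phi : T -> int) : Prop :=
  colouring k phi /\ same_smultigraph (reduced G sigma phi) (Kstar k).

Definition is_max (P : nat -> Prop) (m : nat) : Prop :=
  P m /\ forall k, P k -> k <= m.

Definition is_achromatic_number (T : finType) (G : sgraph T)
    (sigma : signature T) : nat -> Prop :=
  is_max (fun k => 1 <= k /\
    exists tau, equivalent G sigma tau /\
      exists phi, complete_colouring G tau k phi).

Definition path_edges (n : nat) : {set {set 'I_n}} :=
  [set e : {set 'I_n} | [exists i : 'I_n, exists j : 'I_n,
     (e == [set i; j]) && (j == i.+1 :> nat)]].

Lemma path_edges_card2 (n : nat) (e : {set 'I_n}) :
  e \in path_edges n -> #|e| = 2.
Proof.
rewrite inE => /existsP[i /existsP[j /andP[/eqP -> /eqP ij]]].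
by rewrite cards2 -val_eqE /= ij neq_ltn ltnSn.
Qed.

Definition path_graph (n : nat) : sgraph 'I_n := SGraph (@path_edges_card2 n).

(* Main.v *)
Require Import Defs.
From mathcomp Require Import all_boot all_order all_algebra.
From mathcomp Require Import zify.

Set Implicit Arguments.
Unset Strict Implicit.
Unset Printing Implicit Defensive.

(** All signatures of a path are equivalent, so a complete [k]-colouring of
    some signed path equivalent to [(P_n, sigma)] amounts to a walk with
    [n - 1] steps in [K_k^*] that uses every edge.  Such a walk has at least as
    many steps as [K_k^*] has edges.  Conversely all degrees of [K_k^*] are
    even, hence it has a closed Eulerian trail, which can be prolonged by going
    back and forth along its last edge.  The trail is built by induction on the
    number of vertices: from the base point go to the new vertex [y] by a
    positive edge, visit every other vertex from [y] and come back, use the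
    loop at [y], and return to the base point by the negative edge. *)

(** * Edges of [Kstar] *)

(* The vertices of [Kstar k] are the integers from [lo] to [m], where
   [m = k./2] and [lo] is [0] or [1] according to whether [k] is odd. *)
Definition kedge (lo m : nat) (s : bool) (i j : nat) : bool :=
  [&& lo <= i <= m, lo <= j <= m & (i == j) ==> s && (i != 0)].

Lemma kedge_sym lo m s i j : kedge lo m s i j = kedge lo m s j i.
Proof. by rewrite /kedge andbCA eq_sym; case: eqVneq => // ->. Qed.

Lemma vertex_Kstar k i : vertex (Kstar k) i = (~~ odd k <= i <= k./2).
Proof. by rewrite /= /colours; case: (odd k); case: i => [|i] /=; rewrite ?andbT ?andbF. Qed.

Lemma mult_Kstar k s i j :
  mult (Kstar k) s i j = kedge (~~ odd k) k./2 s i j.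
Proof.
rewrite /kedge -!vertex_Kstar /=.
by case: (colours k i); case: (colours k j) => //=; case: (i == j).
Qed.

(** The number of edges of [Kstar k], loops included, in the form of the bounds of the theorem: [h]
    vertices span [h * (h - 1)] non-loop edges, and all of them carry a loop except the vertex
    [0]. *)
Definition kedge_count (k : nat) : nat :=
  if odd k then (k./2 + 1) ^ 2 - 1 else k./2 ^ 2.

Lemma kedge_countE k : 0 < k ->
  kedge_count k =
  (k./2 - ~~ odd k) ^ 2 + (k./2 - ~~ odd k).*2 + ~~ odd k.
Proof.
move=> k0; rewrite /kedge_count; have := odd_double_half k.
by case: (odd k) => /=; nia.
Qed.

(** Each undirected edge is listed once, smaller end first. The base [nseq lo] encodes that the
    first vertex has a loop exactly when it is [1], not [0]. *)
Fixpoint kedge_seq (lo d : nat) : seq (bool * nat * nat) :=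
  if d is d'.+1 then
    let y := lo + d in
    (true, y, y) :: [seq (s, i, y) | s <- [:: false; true], i <- iota lo d]
      ++ kedge_seq lo d'
  else nseq lo (true, lo, lo).

Lemma size_kedge_seq lo d : size (kedge_seq lo d) = d ^ 2 + d.*2 + lo.
Proof.
elim: d => [|d IHd]; first by rewrite /= size_nseq.
by rewrite /kedge_seq -/kedge_seq /= !size_cat /= !size_cat !size_map
  !size_iota IHd /=; nia.
Qed.

Lemma mem_kedge_seq lo d s i j : lo <= 1 -> (s, i, j) \in kedge_seq lo d ->
  (i <= j) && kedge lo (lo + d) s i j.
Proof.
move=> lo1; elim: d => [|d IHd].
  by case: lo lo1 => [|[|]] //= _; rewrite inE => /eqP[-> -> ->].
rewrite /kedge_seq -/kedge_seq inE mem_cat => /or3P[/eqP[-> -> ->]||/IHd].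
- by rewrite /kedge; lia.
- case/allpairsP=> -[s' i'] [_]; rewrite mem_iota /= => hi [-> -> ->].
  by rewrite /kedge; lia.
- by rewrite /kedge; lia.
Qed.

Lemma kedge_seq_uniq lo d : lo <= 1 -> uniq (kedge_seq lo d).
Proof.
move=> lo1; elim: d => [|d IHd]; first by case: lo lo1 => [|[|]].
rewrite /kedge_seq -/kedge_seq cons_uniq cat_uniq IHd andbT mem_cat negb_or.
apply/and3P; split.
- apply/andP; split.
  + by apply/allpairsP=> -[[s i] [_]]; rewrite mem_iota /= => hi []; lia.
  + by apply/negP=> /(mem_kedge_seq lo1); rewrite /kedge; lia.
- by apply: allpairs_uniq; rewrite ?iota_uniq // => -[a b] [a' b'] _ _ [-> ->].
- apply/hasPn=> -[[s i] j] /(mem_kedge_seq lo1) h; apply/negP.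
  by case/allpairsP=> -[a b] [_ _ [_ _ jE]]; move: h; rewrite jE /kedge; lia.
Qed.

(** * Covering walks in [Kstar] *)

(* A walk is given by its starting point and the list of its steps, each one
   recorded as the sign of the edge followed and the vertex reached. *)
Fixpoint walk_edges (u : nat) (w : seq (bool * nat)) : seq (bool * nat * nat) :=
  if w is (s, v) :: w' then (s, u, v) :: walk_edges v w' else [::].

Lemma walk_edges_cat u w1 w2 :
  walk_edges u (w1 ++ w2) =
  walk_edges u w1 ++ walk_edges (last u (unzip2 w1)) w2.
Proof. by elim: w1 u => [|[s v] w1 IH] u //=; rewrite IH. Qed.

Lemma size_walk_edges u w : size (walk_edges u w) = size w.
Proof. by elim: w u => [|[s v] w IH] u //=; rewrite IH. Qed.

Lemma nth_walk_edges t u w p : p < size w ->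
  nth t (walk_edges u w) p =
  (nth false (unzip1 w) p, nth u (u :: unzip2 w) p,
   nth u (u :: unzip2 w) p.+1).
Proof.
elim: w u p => [|[s v] w IH] u [|p] //= hp; rewrite IH //=.
have pE : p < size (unzip2 w) by rewrite size_map.
by rewrite -!(set_nth_default u v) //=; exact: ltnW.
Qed.

Definition covering_walk (lo m : nat) (w : seq (bool * nat)) : Prop :=
  {in walk_edges lo w, forall t, kedge lo m t.1.1 t.1.2 t.2} /\
  forall s i j, kedge lo m s i j ->
    (s, i, j) \in walk_edges lo w \/ (s, j, i) \in walk_edges lo w.

Fixpoint tour (lo d : nat) : seq (bool * nat) :=
  if d is d'.+1 then
    let y := lo + d in
    tour lo d' ++ (false, y) ::
      flatten [seq [:: (false, v); (true, y)] | v <- iota lo.+1 d']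
      ++ [:: (true, y); (true, lo)]
  else nseq lo (true, lo).

(** The value agrees with [size_kedge_seq], so a covering tour is automatically Eulerian: no
    separate proof that edges are not repeated is required. *)
Lemma size_tour lo d : size (tour lo d) = d ^ 2 + d.*2 + lo.
Proof.
elim: d => [|d IHd]; first by rewrite /= size_nseq.
rewrite /tour -/tour size_cat IHd /= size_cat /=.
set f := flatten _; have -> : size f = d.*2; last by nia.
rewrite /f; move: (lo + _) => y.
by elim: {+}d lo.+1 {IHd f} => //= d' IH l; rewrite IH.
Qed.

Lemma walk_edges_excursions y vs :
  let w := flatten [seq [:: (false, v); (true, y)] | v <- vs] in
  walk_edges y w = flatten [seq [:: (false, y, v); (true, v, y)] | v <- vs] /\
  last y (unzip2 w) = y.
Proof. by elim: vs => //= v vs [-> ->]. Qed.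

Lemma last_tour lo d : lo <= 1 -> last lo (unzip2 (tour lo d)) = lo.
Proof.
case: d => [|d]; first by case: lo => [|[|]].
by move=> _; rewrite /tour -/tour /unzip2 map_cat last_cat /= map_cat last_cat.
Qed.

Lemma walk_edges_tourS lo d : lo <= 1 ->
  let y := lo + d.+1 in
  walk_edges lo (tour lo d.+1) =
  walk_edges lo (tour lo d) ++ (false, lo, y) ::
    flatten [seq [:: (false, y, v); (true, v, y)] | v <- iota lo.+1 d]
    ++ [:: (true, y, y); (true, y, lo)].
Proof.
move=> lo1; rewrite /tour -/tour walk_edges_cat last_tour //= walk_edges_cat.
by have [-> ->] := walk_edges_excursions (lo + d.+1) (iota lo.+1 d).
Qed.

Lemma tour_covering lo d : lo <= 1 -> covering_walk lo (lo + d) (tour lo d).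
Proof.
move=> lo1; elim: d => [|d [IHv IHc]].
  case: lo lo1 => [|[|]] //= _; split=> //.
  - by move=> s i j; rewrite /kedge; lia.
  - by move=> t; rewrite inE => /eqP ->.
  - move=> s i j; rewrite /kedge inE => /and3P[i1 j1].
    have [-> ->] : i = 1 /\ j = 1 by lia.
    by case: s => //; left.
split=> [t|s i j].
  rewrite walk_edges_tourS // mem_cat inE mem_cat !inE.
  case/or4P=> [/IHv||/flatten_mapP[v]|/orP[]/eqP->]; rewrite /kedge /=.
  - by lia.
  - by move/eqP=> -> /=; lia.
  - rewrite mem_iota !inE => hv /orP[]/eqP-> /=; lia.
  - by lia.
  - by lia.
rewrite walk_edges_tourS //.
wlog ij : i j / i <= j => [hw|].
  by case: (leqP i j) => [/hw//|/ltnW/hw h]; rewrite kedge_sym => /h[]; auto.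
(* Edges avoiding the new vertex are covered by induction. The others are its loop, its two edges to
   [lo], and its two edges to each vertex in between. *)
move=> kij; have [jd|jd] := leqP j (lo + d).
  have /IHc[h|h] : kedge lo (lo + d) s i j by move: kij; rewrite /kedge; lia.
    by left; rewrite mem_cat h.
  by right; rewrite mem_cat h.
have -> : j = lo + d.+1 by move: kij; rewrite /kedge; lia.
have [iy|iy] := eqVneq i (lo + d.+1).
  have -> : s = true by move: kij; rewrite /kedge; lia.
  by left; rewrite iy mem_cat inE mem_cat !inE eqxx !orbT.
have [->|ilo] := eqVneq i lo.
  case: s {kij} => /=; [right | left];
  by rewrite mem_cat inE ?mem_cat !inE eqxx !orbT.
have iv : i \in iota lo.+1 d by rewrite mem_iota; move: kij; rewrite /kedge; lia.
case: s {kij}; [left | right]; rewrite mem_cat inE mem_cat;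
  by apply/or4P/Or43/flatten_mapP; exists i; rewrite // !inE eqxx ?orbT.
Qed.

(** Each extra step follows the last edge backwards, which is legal by [kedge_sym]; a last edge
    exists since the walk is nonempty. *)
Lemma covering_walk_extend lo m w r : 0 < size w -> covering_walk lo m w ->
  exists2 w', size w' = size w + r & covering_walk lo m w'.
Proof.
move=> w0 cw; elim: r => [|r [w' sw' [vw' cw']]].
  by exists w; rewrite ?addn0.
case/lastP: w' sw' vw' cw' => [|w1 [s v]] sw' vw' cw'.
  by move: sw' => /=; lia.
exists (rcons (rcons w1 (s, v)) (s, last lo (unzip2 w1))).
  by rewrite size_rcons sw' addnS.
move: vw' cw'; rewrite /covering_walk -!cats1 !walk_edges_cat.
rewrite [unzip2 (_ ++ _)]map_cat last_cat /=; set u := last lo _ => vw' cw'.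
split=> [t|s' i j /cw'[]]; last 2 first.
- by move=> h; left; rewrite mem_cat h.
- by move=> h; right; rewrite mem_cat h.
rewrite mem_cat => /orP[/vw'//|]; rewrite inE => /eqP-> /=.
rewrite kedge_sym; apply: (vw' (s, u, v)).
by rewrite mem_cat inE eqxx orbT.
Qed.

(** * Signed paths *)

(** Indexing by a plain [p] through [inord] avoids carrying bound proofs; the value is the intended
    edge only for [p < n]. *)
Definition path_edge (n p : nat) : {set 'I_n.+1} := [set inord p; inord p.+1].

Lemma path_edgesP n (e : {set 'I_n.+1}) :
  reflect (exists2 p, p < n & e = path_edge n p) (e \in edges (path_graph n.+1)).
Proof.
rewrite inE; apply: (iffP existsP) => [[i /existsP[j /andP[/eqP-> /eqP ij]]]|[p pn ->]].
  by exists (i : nat); [have := ltn_ord j; lia | rewrite /path_edge -ij !inord_val].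
by exists (inord p); apply/existsP; exists (inord p.+1); rewrite eqxx /= !inordK //; lia.
Qed.

Lemma set2_eq (T : finType) (a b u v : T) :
  [set a; b] = [set u; v] -> (u = a /\ v = b) \/ (u = b /\ v = a).
Proof.
move/setP=> E; have := E u; have := E v; have := E a; have := E b.
rewrite !inE !eqxx ?orbT /= => /esym/orP h1 /esym/orP h2 /orP h3 /orP h4.
by case: h1 => /eqP h1; case: h2 => /eqP h2; case: h3 => /eqP h3;
   case: h4 => /eqP h4; subst; auto.
Qed.

Lemma path_edge_inj n p q : p < n -> q < n -> path_edge n p = path_edge n q -> p = q.
Proof.
move=> pn qn /set2_eq[][/(congr1 val) + /(congr1 val)];
by rewrite /= !inordK; lia.
Qed.

Lemma card_set2I_eq1 (T : finType) (u v : T) (S : {set T}) : u != v ->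
  (#|[set u; v] :&: S| == 1) = (u \in S) (+) (v \in S).
Proof.
move=> uv; rewrite setIUl cardsU.
have I1 (x : T) : [set x] :&: S = if x \in S then [set x] else set0.
  by apply/setP=> z; case: ifP => xS; rewrite !inE; case: eqVneq => // ->.
rewrite !I1; case: (u \in S); case: (v \in S);
  rewrite ?setI0 ?set0I ?cards0 ?cards1 //.
have -> : [set u] :&: [set v] = set0; last by rewrite cards0.
by apply/setP=> z; rewrite !inE; case: eqVneq => // ->; rewrite (negbTE uv).
Qed.

(** The switching set is found by walking along the path: membership, tracked by [a], flips exactly
    at the edges where [sigma] and [tau] differ. No cycle imposes a constraint. *)
Lemma path_equivalent n (sigma tau : signature 'I_n.+1) :
  equivalent (path_graph n.+1) sigma tau.
Proof.
pose a := fix a p := if p is q.+1 then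
  a q (+) sigma (path_edge n q) (+) tau (path_edge n q) else false.
exists [set v : 'I_n.+1 | a v] => e /path_edgesP[p pn ->].
rewrite /switch card_set2I_eq1; last first.
  by apply/negP=> /eqP/(congr1 val); rewrite /= !inordK; lia.
rewrite !inE !inordK ?ltnS //=; last by exact: ltnW.
by case: (a p); case: (sigma _); case: (tau _).
Qed.

Definition joins (T : Type) (a b i j : T) : Prop :=
  (a = i /\ b = j) \/ (a = j /\ b = i).

Lemma mult_path_gt0 n (sigma : signature 'I_n.+1) (c : 'I_n.+1 -> nat) s i j :
  0 < mult (identify (path_graph n.+1) sigma c) s i j <->
  exists p, [/\ p < n, sigma (path_edge n p) = s
              & joins (c (inord p)) (c (inord p.+1)) i j].
Proof.
split=> [/card_gt0P[e]|[p [pn sE ij]]].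
  rewrite inE => /andP[/path_edgesP[p pn ->] /andP[/eqP sE]].
  case/existsP=> u /existsP[v /and3P[/eqP/set2_eq E /eqP ci /eqP cj]].
  by exists p; split=> //; case: E => -[uE vE]; subst; [left | right].
apply/card_gt0P; exists (path_edge n p); rewrite inE sE eqxx andTb.
apply/andP; split; first by apply/path_edgesP; exists p.
apply/existsP; case: ij => -[ci cj].
  by exists (inord p); apply/existsP; exists (inord p.+1); rewrite eqxx ci cj !eqxx.
exists (inord p.+1); apply/existsP; exists (inord p).
by rewrite /path_edge setUC eqxx ci cj !eqxx.
Qed.

(** * Complete colourings of signed paths *)

Lemma complete_colouring_path_count n (tau : signature 'I_n.+1) k phi : 0 < k ->
  complete_colouring (path_graph n.+1) tau k phi -> kedge_count k <= n.
Proof.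
move=> k0 [_ [_ hm]]; rewrite kedge_countE // -size_kedge_seq.
set lo := nat_of_bool _; set d := _ - _.
have lo1 : lo <= 1 by rewrite /lo; case: odd.
have dE : lo + d = k./2.
  by rewrite /d /lo; move: (odd_double_half k); case: odd => /=; lia.
pose c v := `|phi v|%N.
pose sg := switch tau [set v | (phi v < 0)%R].
(* [f] sends a path edge to its image in the reduced graph, with ends sorted as in [kedge_seq].
   Completeness makes it reach every edge, so there are at most [n] of them. *)
pose f p := let a := c (inord p) in let b := c (inord p.+1) in
  (sg (path_edge n p), minn a b, maxn a b).
suff: size (kedge_seq lo d) <= size (map f (iota 0 n)).
  by rewrite size_map size_iota.
apply: uniq_leq_size; first exact: kedge_seq_uniq.
move=> [[s i] j] /(mem_kedge_seq lo1); rewrite dE => /andP[ij kij].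
have := hm s i j; rewrite mult_Kstar kij /= => hmin.
have /mult_path_gt0[p [pn sE cij]] :
  0 < mult (identify (path_graph n.+1) sg c) s i j.
  by move: hmin; rewrite /sg /c /=; lia.
apply/mapP; exists p; first by rewrite mem_iota.
rewrite /f sE; case: cij => -[-> ->]; congr (_, _, _); lia.
Qed.

(** The walk is read along the path: the [p]-th vertex takes as colour the vertex visited at time
    [p], and the [p]-th edge the sign of that step. *)
Lemma complete_colouring_of_walk n k w : 0 < k -> size w = n ->
  covering_walk (~~ odd k) k./2 w ->
  exists (tau : signature 'I_n.+1) (phi : 'I_n.+1 -> int),
    complete_colouring (path_graph n.+1) tau k phi.
Proof.
move=> k0 sw; set lo := nat_of_bool _ => -[vw cw].
pose c p := nth lo (lo :: unzip2 w) p.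
pose sg p := nth false (unzip1 w) p.
pose tau : signature 'I_n.+1 :=
  fun e => [exists p : 'I_n, (e == path_edge n p) && sg p].
have tauE p : p < n -> tau (path_edge n p) = sg p.
  move=> pn; apply/existsP/idP => [[q /andP[/eqP/path_edge_inj -> //]]|sp].
  by exists (Ordinal pn); rewrite eqxx.
have nthE p : p < n -> nth (false, 0, 0) (walk_edges lo w) p = (sg p, c p, c p.+1).
  by move=> pn; rewrite nth_walk_edges ?sw.
have cV p : p < n.+1 -> lo <= c p <= k./2.
  case: p => [_|p pn].
    by rewrite /c /= /lo; move: (odd_double_half k); case: odd => /=; lia.
  have /vw : (sg p, c p, c p.+1) \in walk_edges lo w.
    by rewrite -nthE ?mem_nth // size_walk_edges sw.
  by case/and3P.
have joinE s i j : (exists p, [/\ p < n, tau (path_edge n p) = s &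
    joins (c (inord p : 'I_n.+1)) (c (inord p.+1 : 'I_n.+1)) i j]) <->
    kedge lo k./2 s i j.
  split=> [[p [pn <-]]|kij].
    rewrite !inordK ?ltnS //; last exact: ltnW.
    rewrite tauE //; have /vw /= : (sg p, c p, c p.+1) \in walk_edges lo w.
      by rewrite -nthE ?mem_nth // size_walk_edges sw.
    by move=> + [][<- <-]; rewrite // kedge_sym.
  have [t [tw tE]] : exists t, t \in walk_edges lo w /\
      (t.1.1 = s /\ joins t.1.2 t.2 i j).
    by case: (cw _ _ _ kij) => h; eexists; split; [exact: h| |exact: h|];
       split=> //; [left | right].
  have /(nthP (false, 0, 0))[p] := tw; rewrite size_walk_edges sw => pn.
  rewrite nthE // => {tw}tw; move: tE; rewrite -{}tw /= => -[sE ij].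
  exists p; split=> //; first by rewrite tauE.
  by rewrite !inordK ?ltnS //; exact: ltnW.
exists tau, (fun v : 'I_n.+1 => Posz (c v)); split.
  by move=> v; move: (cV v (ltn_ord v)); rewrite -vertex_Kstar.
split=> [i|s i j].
  rewrite vertex_Kstar -/lo /=; apply/existsP/idP => [[v /eqP <-]|iV].
    by apply: cV.
  (* The walk starts at [lo], and any other vertex is reached because it is an end of an edge from
     [lo]. *)
  have [->|ilo] := eqVneq i lo; first by exists ord0.
  have /joinE[p [_ _ ij]] : kedge lo k./2 true lo i.
    by move: iV ilo; rewrite /kedge; lia.
  by case: ij => -[/eqP ci /eqP cj]; [exists (inord p.+1) | exists (inord p)].
rewrite mult_Kstar -/lo.
(* All colours are nonnegative, so the reduction switches the empty set. *)
have sw0 e : switch tau [set v : 'I_n.+1 | (Posz (c v) < 0)%R] e = tau e.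
  have -> : [set v : 'I_n.+1 | (Posz (c v) < 0)%R] = set0.
    by apply/setP=> v; rewrite !inE.
  by rewrite /switch setI0 cards0 addbF.
set M := reduced _ _ _.
suff: 0 < mult M s i j <-> kedge lo k./2 s i j.
  have : mult M s i j <= 1 by exact: geq_minl.
  by case: (mult M s i j) (kedge _ _ _ _ _) => [|[|]] // [] _ [h1 h2] //;
    [have := h2 isT | have := h1 isT].
rewrite -joinE /M /= leq_min ltnSn andTb.
split=> [/mult_path_gt0[p [pn pE ij]]|[p [pn pE ij]]].
  by exists p; rewrite -sw0.
by apply/mult_path_gt0; exists p; rewrite sw0.
Qed.

Theorem theorem2p14 (n : nat) (hn : 1 <= n) (sigma : signature 'I_n) :
  exists psi : nat,
    is_achromatic_number (path_graph n) sigma psi /\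
    is_max (fun m : nat =>
      (exists x : nat, x ^ 2 <= n - 1 /\ m = 2 * x) \/
      (exists x : nat, (x + 1) ^ 2 - 1 <= n - 1 /\ m = 2 * x + 1)) psi.
Proof.
(* From here on [n] counts the edges of the path, which has [n.+1] vertices. *)
case: n hn sigma => // n _ sigma; rewrite subn1 /=.
have setE m : ((exists x : nat, x ^ 2 <= n /\ m = 2 * x) \/
    (exists x : nat, (x + 1) ^ 2 - 1 <= n /\ m = 2 * x + 1)) <->
    kedge_count m <= n.
  rewrite /kedge_count; split=> [[[x [xn ->]]|[x [xn ->]]]|].
  - by rewrite mul2n odd_double doubleK.
  - by rewrite mul2n addn1 /= odd_double /= uphalf_double.
  - by have := odd_double_half m; case: (odd m) => /= mE h; [right | left];
       exists m./2; split=> //; lia.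
(* A crude bound, enough for the maximum [psi] to exist. *)
have bound m : kedge_count m <= n -> m <= n.*2.+1.
  by rewrite /kedge_count; have := odd_double_half m; case: (odd m) => /=; nia.
have ex1 : exists m, kedge_count m <= n by exists 1.
case: (ex_maxnP ex1 bound) => psi psin psimax.
have psi0 : 0 < psi by apply: psimax.
exists psi; split; last by split; [exact/setE | move=> k /setE/psimax].
split=> [|k [k0 [tau [_ [phi /(complete_colouring_path_count k0)]]]]]; last exact: psimax.
split=> //.
suff [tau [phi cphi]] : exists (tau : signature 'I_n.+1) (phi : 'I_n.+1 -> int),
    complete_colouring (path_graph n.+1) tau psi phi.
  by exists tau; split; [exact: path_equivalent | exists phi].
suff [w sw cw] : exists2 w, size w = n & covering_walk (~~ odd psi) psi./2 w.
  exact: complete_colouring_of_walk psi0 sw cw.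
have lo1 : ~~ odd psi <= 1 by case: odd.
have psiE : ~~ odd psi + (psi./2 - ~~ odd psi) = psi./2.
  by move: (odd_double_half psi); case: odd => /=; lia.
have := tour_covering (psi./2 - ~~ odd psi) lo1; rewrite psiE.
have := size_tour (~~ odd psi) (psi./2 - ~~ odd psi); rewrite -kedge_countE //.
(* An empty tour cannot be prolonged, but it forces [n = 0]: otherwise [kedge_count 2 = 1] gives
   [2 <= psi], and then [Kstar psi] has an edge. *)
move=> ts tc; have [t0|t0] := posnP (size (tour (~~ odd psi) (psi./2 - ~~ odd psi))).
  exists (tour (~~ odd psi) (psi./2 - ~~ odd psi)) => //.
  rewrite t0; apply/esym/eqP; rewrite -leqn0 leqNgt; apply/negP => n0.
  have : 2 <= psi by apply: psimax.
  by move: t0; rewrite ts /kedge_count; have := odd_double_half psi; case: odd => /=; nia.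
have [w sw cw] := covering_walk_extend (n - kedge_count psi) t0 tc.
by exists w; rewrite // sw ts subnKC.
Qed.
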